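(* Let $X$ be a complex Hilbert space, and let $A : D(A)\to X$ and $H : D(H)\to X$ be densely defined self-adjoint operators on $X$ (with domains $D(A), D(H)\subset X$). Suppose that $e^{-itH}$ leaves $D(A)\cap D(H)$ invariant for all $t\in\mathbb{R}$, i.e. $e^{-itH}\psi\in D(A)\cap D(H)$ for all $\psi\in D(A)\cap D(H)$ and all $t\in\mathbb{R}$. Then for any $\psi_0\in D(A)\cap D(H)$, setting $\psi(t):=e^{-itH}\psi_0$, the function $t\mapsto \langle A\rangle_{\psi(t)} = \langle \psi(t), A\psi(t)\rangle$ is continuously differentiable on $\mathbb{R}$ and satisfies $$\frac{d}{dt}\langle A\rangle_{\psi(t)} = i\,\langle [H,A]\rangle_{\psi(t)}\quad\text{for all } t\in\mathbb{R},$$ where the right-hand side is understood in the inner product sense $$\langle [H,A]\rangle_{\psi} := \langle H\psi, A\psi\rangle - \langle A\psi, H\psi\rangle \qquad (\psi\in D(A)\cap D(H)).$$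
   Context: Operators are linear and possibly unbounded. The inner product $\langle\cdot,\cdot\rangle$ on $X$ is antilinear in the first argument and linear in the second. For $\phi\in D(A)$, $\langle A\rangle_\phi := \langle \phi, A\phi\rangle$. The family $(e^{-itH})_{t\in\mathbb{R}}$ is the strongly continuous one-parameter unitary group generated by the self-adjoint operator $H$; for $\psi_0\in D(H)$, $\psi(t)=e^{-itH}\psi_0$ solves $i\frac{d}{dt}\psi(t)=H\psi(t)$. *)

(* Defs.v *)
From HB Require Import structures.
From mathcomp Require Import all_boot all_order all_algebra sesquilinear.
From mathcomp Require Import all_classical all_reals all_analysis.
From mathcomp Require Export complex.

Set Implicit Arguments.
Unset Strict Implicit.
Unset Printing Implicit Defensive.

Import Order.TTheory GRing.Theory Num.Theory.
Import numFieldNormedType.Exports.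

Local Open Scope classical_set_scope.
Local Open Scope ring_scope.
Local Open Scope complex_scope.

HB.mixin Record CompleteNormedModule_isHilbert (R : realType) X
    & CompleteNormedModule R[i] X := {
  hform : {dot X for @Num.conj R[i]} ;
  sqr_norm_hform : forall x : X, `|x| ^+ 2 = hform x x
}.

#[short(type="hilbertType")]
HB.structure Definition Hilbert (R : realType) :=
  {X of CompleteNormedModule R[i] X & CompleteNormedModule_isHilbert R X}.

(* A [{dot X for Num.conj}] form is linear in its first argument and antilinear
   in its second; [inner] uses the opposite convention (antilinear in the first
   argument), hence the swap. *)
Definition inner (R : realType) (X : hilbertType R) (phi psi : X) : R[i] :=
  hform psi phi.

(* The values of [op] outside [dom] are irrelevant: everything below uses [op]
   on [dom] only. *)
Record unbounded_op (R : realType) (X : hilbertType R) := UnboundedOp {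
  dom : set X ;
  op :> X -> X ;
  dom0 : dom 0 ;
  dom_lin : forall (a : R[i]) x y, dom x -> dom y -> dom (a *: x + y) ;
  op_lin : forall (a : R[i]) x y, dom x -> dom y ->
    op (a *: x + y) = a *: op x + op y
}.

Section Operators.
Context {R : realType} {X : hilbertType R}.
Implicit Types A H : unbounded_op X.

Definition graph A : set (X * X) := [set p | dom A p.1 /\ p.2 = A p.1].

(* Graph of the adjoint; it is single-valued when [dom A] is dense. *)
Definition adjoint_graph A : set (X * X) :=
  [set p | forall psi, dom A psi -> inner p.1 (A psi) = inner p.2 psi].

Definition self_adjoint A := dense (dom A) /\ graph A = adjoint_graph A.

Definition op_expectation A (psi : X) : R[i] := inner psi (A psi).

Definition commutator_expectation H A (psi : X) : R[i] :=
  inner (H psi) (A psi) - inner (A psi) (H psi).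

End Operators.

(* [derivable] and [is_derive] require source and target to be normed modules
   over the same field, so for a function of a real variable into a complex
   normed space the difference quotient is written out. *)
Definition has_derivative {R : realType} {V : normedModType R[i]}
    (f : R -> V) (t : R) (l : V) : Prop :=
  (fun h : R => (h^-1)%:C *: (f (h + t) - f t)) @ 0^' --> l.

Definition continuously_differentiable {R : realType} {V : normedModType R[i]}
    (f : R -> V) : Prop :=
  exists2 f' : R -> V, forall t, has_derivative f t (f' t) & continuous f'.

(* Unitarity: preservation of the inner product together with the group law,
   which makes every [U t] invertible. *)
Definition unitary_group {R : realType} {X : hilbertType R}
    (U : R -> {linear X -> X}) : Prop :=
  [/\ forall psi, U 0 psi = psi,
      forall s t psi, U (s + t) psi = U s (U t psi),
      forall t phi psi, inner (U t phi) (U t psi) = inner phi psi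
    & forall psi, continuous (fun t => U t psi)].

(* [U t] = e^{-itH}: the infinitesimal generator of [U], with its maximal domain
   (the vectors at which the derivative at 0 exists), is -iH. By Stone's theorem
   there is exactly one such [U] when [H] is self-adjoint. *)
Definition unitary_group_generated_by {R : realType} {X : hilbertType R}
    (H : unbounded_op X) (U : R -> {linear X -> X}) : Prop :=
  unitary_group U /\
  graph H = [set p | has_derivative (fun t => U t p.1) 0 (- ('i *: p.2))].

(* Main.v *)
Require Import Defs.
From mathcomp Require Import all_boot all_order all_algebra.
From mathcomp Require Import all_classical all_reals all_analysis.
From mathcomp Require Import sesquilinear ring lra.
Import Order.TTheory GRing.Theory Num.Theory.
Import numFieldNormedType.Exports.
Local Open Scope classical_set_scope.
Local Open Scope ring_scope.
Local Open Scope complex_scope.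

Set Implicit Arguments.
Unset Strict Implicit.
Unset Printing Implicit Defensive.

(** Put [psi t = U t psi0].  The difference quotient of [<psi, A psi>] at [t] is
    [<(psi (t+h) - psi t)/h, A psi (t+h)> + <A psi t, (psi (t+h) - psi t)/h>], so
    the point is that [A psi] is weakly continuous.  Testing against the dense
    domain of [A], this reduces to [A psi] being locally bounded.
    The norm of [A x] is lower semicontinuous in [x], whence two Baire arguments:
    on the time axis, [A psi] is bounded near some [t0]; on the intersection of
    the domains, complete for [|x| + |A x| + |H x|], each [A U_t] is bounded.
    Writing [psi s = U_(t - t0) (psi (s + t0 - t))] carries the bound near [t0] to
    any [t]. *)

(* Over [R[i]] norms, and hence radii of balls, are themselves complex numbers. *)
Definition rnorm (R : realType) (V : normedModType R[i]) (x : V) : R :=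
  complex.Re `|x|.

(** * Calculus with the real-valued norm *)

Section RealNorm.
Context {R : realType} {V : normedModType R[i]}.
Implicit Types x y : V.

Lemma rnormE x : `|x| = (rnorm x)%:C.
Proof. by rewrite /rnorm RRe_real ?normr_real. Qed.

Lemma rnorm_ge0 x : 0 <= rnorm x.
Proof. by rewrite -lecR -rnormE; apply: normr_ge0. Qed.

Lemma rnorm0 : rnorm (0 : V) = 0.
Proof. by rewrite /rnorm normr0. Qed.

Lemma rnorm_eq0 x : (rnorm x == 0) = (x == 0).
Proof. by rewrite -[RHS]normr_eq0 rnormE -(inj_eq (@complexI R)). Qed.

Lemma rnormN x : rnorm (- x) = rnorm x.
Proof. by rewrite /rnorm normrN. Qed.

Lemma rdistC x y : rnorm (x - y) = rnorm (y - x).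
Proof. by rewrite /rnorm distrC. Qed.

Lemma rnormD x y : rnorm (x + y) <= rnorm x + rnorm y.
Proof. by rewrite -lecR -rnormE rmorphD/= -!rnormE ler_normD. Qed.

Lemma rdistD x y z : rnorm (x - z) <= rnorm (x - y) + rnorm (y - z).
Proof. by rewrite (le_trans _ (rnormD _ _))// addrA subrK. Qed.

(** A positive element of [R[i]] is real, so the radii of balls may be taken in [R]. *)
Lemma cvg_rnormP T {F : set_system T} {FF : Filter F} (f : T -> V) (l : V) :
  f @ F --> l <->
  (forall e, 0 < e -> \forall t \near F, rnorm (f t - l) <= e).
Proof.
split=> [/cvgrPdistC_le fl e e0|fl].
  have /fl : 0 < e%:C by rewrite ltcR.
  by apply: filterS => t; rewrite [X in X <= _ -> _]rnormE lecR.
apply/cvgrPdistC_le => e e0.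
have eE : e = (complex.Re e)%:C by rewrite RRe_real// gtr0_real.
move: e0; rewrite eE ltcR => /fl; apply: filterS => t.
by move=> ?; rewrite rnormE lecR.
Qed.

End RealNorm.

Lemma rnorm_cauchy (R : realType) (W : completeNormedModType R[i]) (u : nat -> W) :
  (forall e, 0 < e -> exists n, forall m, (n <= m)%N -> rnorm (u m - u n) <= e) ->
  exists l : W, u @ \oo --> l.
Proof.
move=> cu; suff /cvg_ex[l ul] : cvg (u @ \oo) by exists l.
apply: cauchy_cvg; apply: cauchy_exP => e e0.
have eE : e = (complex.Re e)%:C by rewrite RRe_real// gtr0_real.
move: e0; rewrite eE ltcR => e0.
have /cu[n un] : 0 < complex.Re e / 2 by lra.
exists (u n); exists n => //= m /un {}un.
rewrite -ball_normE/= rnormE ltcR rdistC.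
by apply: le_lt_trans un _; lra.
Qed.

Lemma rnormZ (R : realType) (V : normedModType R[i]) (a : R[i]) (x : V) :
  rnorm (a *: x) = rnorm (a : R[i]^o) * rnorm x.
Proof.
by apply: complexI; rewrite rmorphM/= -!rnormE normrZ.
Qed.

Lemma rnormZr (R : realType) (V : normedModType R[i]) (a : R) (x : V) :
  rnorm (a%:C *: x) = `|a| * rnorm x.
Proof.
rewrite rnormZ; congr (_ * _); apply: complexI.
by rewrite -rnormE normc_def/= expr0n addr0 sqrtr_sqr.
Qed.

(** * Sesquilinearity and the Cauchy-Schwarz inequality *)

Section Inner.
Context {R : realType} {X : hilbertType R}.
Implicit Types (x y z : X) (a : R[i]).

Lemma innerBl x y z : inner (x - y) z = inner x z - inner y z.
Proof. exact: linearBr. Qed.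

Lemma innerBr x y z : inner x (y - z) = inner x y - inner x z.
Proof. exact: linearBl. Qed.

Lemma innerZl a x y : inner (a *: x) y = a^*%C * inner x y.
Proof. exact: linearZr_LR. Qed.

Lemma innerZr a x y : inner x (a *: y) = a * inner x y.
Proof. exact: linearZl_LR. Qed.

Lemma innerNl x y : inner (- x) y = - inner x y.
Proof. exact: linearNr. Qed.

Lemma innerNr x y : inner x (- y) = - inner x y.
Proof. exact: linearNl. Qed.

Lemma inner_conj x y : (inner x y)^*%C = inner y x.
Proof. by rewrite /inner [RHS]hermC/= expr0 mul1r. Qed.

Lemma inner_norm x : inner x x = (rnorm x ^+ 2)%:C.
Proof. by rewrite rmorphXn/= -rnormE /inner -sqr_norm_hform. Qed.

Lemma cauchy_schwarz x y : rnorm (inner x y : R[i]^o) <= rnorm x * rnorm y.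
Proof.
have [->|y0] := eqVneq y 0.
  by rewrite /inner linear0l !rnorm0 mulr0.
have ny0 : 0 < rnorm y by rewrite lt_neqAle eq_sym rnorm_eq0 y0 rnorm_ge0.
set n := rnorm y in ny0 *; set b := inner x y.
have bb : b * b^*%C = (rnorm (b : R[i]^o) ^+ 2)%:C.
  by rewrite rmorphXn/= -rnormE sqr_normc.
(* This vector is [n ^+ 2] times the component of [x] orthogonal to [y]; the scaling avoids a
   division. That its squared norm is nonnegative is the inequality. *)
have zz : inner ((n ^+ 2)%:C *: x - b^*%C *: y) ((n ^+ 2)%:C *: x - b^*%C *: y) =
    (n ^+ 2 * (n ^+ 2 * rnorm x ^+ 2 - rnorm (b : R[i]^o) ^+ 2))%:C.
  rewrite innerBl !innerBr !innerZl !innerZr conjcK.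
  rewrite -/b -[inner y x]inner_conj -/b !inner_norm -/n.
  rewrite !conjc_real.
  rewrite [RHS]rmorphM/= rmorphB/= [(n ^+ 2 * rnorm x ^+ 2)%:C]rmorphM/= -bb; ring.
move: zz; rewrite inner_norm => /complexI zz.
have := sqr_ge0 (rnorm ((n ^+ 2)%:C *: x - b^*%C *: y)).
rewrite zz pmulr_rge0 ?exprn_gt0// subr_ge0 -exprMn.
by rewrite ler_sqr ?nnegrE ?mulr_ge0 ?rnorm_ge0// mulrC.
Qed.

End Inner.

(** * Limits of inner products and testing against a dense set *)

Section Convergence.
Context {R : realType} {X : hilbertType R}.

Lemma cvg_innerl T {F : set_system T} {FF : Filter F} (u : T -> X) (l y : X) :
  u @ F --> l ->
  (fun t => inner (u t) y : R[i]^o) @ F --> (inner l y : R[i]^o).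
Proof.
move=> /cvg_rnormP ul; apply/cvg_rnormP => e e0.
have y0 := rnorm_ge0 y.
have /ul : 0 < e / (rnorm y + 1) by rewrite divr_gt0//; lra.
apply: filterS => t; rewrite ler_pdivlMr; last by lra.
rewrite -innerBl; have := cauchy_schwarz (u t - l) y.
by have := rnorm_ge0 (u t - l); nra.
Qed.

Lemma dense_rnorm (D : set X) (w : X) (e : R) :
  dense D -> 0 < e -> exists2 x, D x & rnorm (x - w) < e.
Proof.
move=> dD e0; have e0' : 0 < e%:C by rewrite ltcR.
have [x [wx Dx]] := dD (ball w e%:C) (ex_intro _ w (ballxx w e0')) (ball_open w e%:C).
exists x => //; move: wx; rewrite -ball_normE/= rnormE ltcR.
by rewrite rdistC.
Qed.

(** The vector [w] itself gives the ratio [rnorm w], so a close enough approximation of [w] in [D]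
    still beats [c]. *)
Lemma dense_dual_witness (D : set X) (w : X) (c : R) :
  dense D -> 0 <= c < rnorm w ->
  exists2 x, D x & c * rnorm x < rnorm (inner x w : R[i]^o).
Proof.
move=> dD /andP[c0 cw]; set W := rnorm w in cw *.
(* For [x] at distance [e] from [w], [rnorm x] is at most [W + e] and the pairing with [w] at least
   [W * (W - e)]. The two sides of [c * (W + e) < W * (W - e)] agree at [e = W * (W - c) / (W + c)];
   half of that is taken. *)
have e0 : 0 < W * (W - c) / (W + c) / 2 by rewrite !divr_gt0// ?mulr_gt0//; lra.
have [x Dx] := dense_rnorm w dD e0.
set d := rnorm (x - w); set e := _ / 2 => de; exists x => //.
have eE : e * (2 * (W + c)) = W * (W - c) by rewrite /e; field; lra.
have xw : rnorm x <= W + d by rewrite addrC -[x in rnorm x](subrK w) rnormD.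
have ww : rnorm (inner w w : R[i]^o) = W ^+ 2.
  apply: complexI; rewrite -rnormE inner_norm.
  by rewrite ger0_norm// ler0c sqr_ge0.
have := rdistD (inner w w : R[i]^o) (inner x w) 0.
rewrite !subr0 ww -innerBl.
have := cauchy_schwarz (w - x) w; rewrite rdistC -/d -/W.
have := rnorm_ge0 (x - w); rewrite -/d.
nra.
Qed.

End Convergence.

(** * Symmetry, closedness and lower semicontinuity of self-adjoint operators *)

Section SelfAdjoint.
Context {R : realType} {X : hilbertType R}.
Variable A : unbounded_op X.
Hypothesis hA : self_adjoint A.

Lemma self_adjoint_sym x y : dom A x -> dom A y -> inner (A x) y = inner x (A y).
Proof.
move=> Ax Ay; have : graph A (x, A x) by [].
by rewrite hA.2 => /(_ _ Ay).
Qed.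

(** The graph is the adjoint graph, which is cut out by equations between inner products, and these
    survive limits. *)
Lemma self_adjoint_closed T {F : set_system T} {FF : ProperFilter F}
    (u : T -> X) (l a : X) : (forall t, dom A (u t)) ->
  u @ F --> l -> (fun t => A (u t)) @ F --> a -> dom A l /\ A l = a.
Proof.
move=> Du ul ua; suff : graph A (l, a) by case.
rewrite hA.2 => y /= Ay.
have ay : (fun t => inner (u t) (A y) : R[i]^o) @ F --> (inner a y : R[i]^o).
  by under eq_fun do rewrite -self_adjoint_sym//; exact: cvg_innerl.
exact: norm_cvg_unique (cvg_innerl ul) ay.
Qed.

(** [rnorm (A z)] is bounded below through the pairing of [A z] with a fixed [x] in the domain. By
    symmetry this pairing is [inner (A x) z] up to conjugation, hence continuous in [z]. *)
Lemma self_adjoint_lsc v c : dom A v -> 0 <= c < rnorm (A v) ->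
  exists2 d, 0 < d &
    forall z, dom A z -> rnorm (z - v) <= d -> c < rnorm (A z).
Proof.
move=> Av cAv; have [x Ax] := dense_dual_witness hA.1 cAv.
set g := rnorm (inner _ _ : _^o) => cxg; have x0 := rnorm_ge0 x; have a0 := rnorm_ge0 (A x).
(* Moving [v] by [d] changes the pairing by at most [rnorm (A x) * d], which must stay below the gap
   [g - c * rnorm x]. The [+ 1] keeps the denominator positive. *)
exists ((g - c * rnorm x) / (2 * (rnorm (A x) + 1))).
  by rewrite divr_gt0//; lra.
move=> z Az; rewrite ler_pdivlMr; last by lra.
have := cauchy_schwarz x (A z).
have := rdistD (inner x (A v) : R[i]^o) (inner x (A z)) 0.
rewrite !subr0 -/g -![inner x (A _)]self_adjoint_sym// -innerBr.
have := cauchy_schwarz (A x) (v - z); rewrite rdistC.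
have := rnorm_ge0 (z - v).
nra.
Qed.

End SelfAdjoint.

(** * Uniform boundedness by a Baire argument *)

(** If [p] were unbounded on every [N]-ball about 0, each set where [p] exceeds [n] would be open
    and dense for [N]. Nested balls then shrink to a point of [D] where [p] exceeds every integer.
    The argument is run by hand because [N], not a topology on [V], measures distance. *)
Lemma lsc_seminorm_bounded (R : realType) (V : zmodType) (D : set V) (N p : V -> R)
    (D0 : D 0) (DD : forall x y, D x -> D y -> D (x + y))
    (DN : forall x, D x -> D (- x))
    (N0 : N 0 = 0)
    (ND : forall x y, D x -> D y -> N (x + y) <= N x + N y)
    (Ncomplete : forall u : nat -> V, (forall n, D (u n)) ->
       (forall e, 0 < e -> exists n, forall m, (n <= m)%N -> N (u m - u n) <= e) ->
       exists2 l, D l & forall e, 0 < e -> \forall n \near \oo, N (l - u n) <= e)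
    (pN : forall x, D x -> p (- x) = p x)
    (pD : forall x y, D x -> D y -> p (x + y) <= p x + p y)
    (plsc : forall x c, D x -> 0 <= c < p x -> exists2 d, 0 < d &
       forall z, D z -> N (z - x) <= d -> c < p z) :
  exists r C, 0 < r /\ forall x, D x -> N x <= r -> p x <= C.
Proof.
have DB x y : D x -> D y -> D (x - y) by move=> Dx Dy; apply: DD => //; exact: DN.
apply: contrapT => unbounded.
have large r C : 0 < r -> exists y, [/\ D y, N y <= r & C < p y].
  move=> r0; apply: contrapT => H; apply: unbounded; exists r, C; split => // x Dx Nx.
  by rewrite leNgt; apply/negP => pxC; apply: H; exists x.
(* The state is a stage number with the centre and radius of a ball. The hypotheses on the state sit
   under the existential so that [choice] yields a total function; states violating them get a dummy
   value. *)
have step (q : nat * (V * R)) : exists s : V * R, D q.2.1 -> 0 < q.2.2 ->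
    [/\ D s.1, 0 < s.2, s.2 <= q.2.2 / 2, N (s.1 - q.2.1) <= q.2.2 / 2 &
      forall z, D z -> N (z - s.1) <= s.2 -> q.1%:R < p z].
  case: q => n [x r] /=; have [Dx|] := pselect (D x); last by exists (x, r).
  have [r0|] := ltP 0 r; last by exists (x, r).
  (* Subadditivity gives [p (x + y) >= p y - p x], so this [y] forces [p] above [n] at the new
     centre. *)
  have [y [Dy Ny py]] := large (r / 2) (n%:R + p x) ltac:(lra).
  pose x' := x + y.
  have Dx' : D x' by exact: DD.
  have px' : n%:R < p x'.
    have := pD x' (- x) Dx' (DN _ Dx).
    by rewrite pN// /x' addrAC subrr add0r => ?; lra.
  have [d d0 dx'] := plsc x' n%:R Dx' ltac:(by rewrite ler0n px').
  exists (x', Num.min d (r / 2)) => _ _ /=; split => //.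
  - by rewrite /= lt_min d0/=; lra.
  - by rewrite ge_min lexx orbT.
  - by rewrite /= /x' addrAC subrr add0r.
  - by move=> z Dz; rewrite le_min => /andP[zd _]; exact: dx'.
have [f fP] := choice step.
pose s := fix s n := if n is m.+1 then f (m, s m) else (0, 1).
have s_ok n : D (s n).1 /\ 0 < (s n).2.
  by elim: n => [|n [Dn rn]]/=; [rewrite ltr01|have [] := fP (n, s n) Dn rn].
have sP n := fP (n, s n) (s_ok n).1 (s_ok n).2.
pose x n := (s n).1; pose r n := (s n).2.
have rP n : r n.+1 <= r n / 2 by have [] := sP n.
have xP n : N (x n.+1 - x n) <= r n / 2 by have [] := sP n.
have large_ball n z : D z -> N (z - x n.+1) <= r n.+1 -> n%:R < p z.
  by have [_ _ _ _] := sP n; exact.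
have Dx n : D (x n) := (s_ok n).1.
have r0 n : 0 < r n := (s_ok n).2.
(* Later balls lie inside earlier ones: a step spends half the radius on moving the centre and keeps
   at most the other half. *)
have ball_le n k : N (x (n + k)%N - x n) + r (n + k)%N <= r n.
  elim: k => [|k IH]; first by rewrite addn0 subrr N0 add0r.
  rewrite addnS.
  have := ND (x (n + k).+1 - x (n + k)%N) (x (n + k)%N - x n)
    (DB _ _ (Dx _) (Dx _)) (DB _ _ (Dx _) (Dx _)).
  by rewrite subrKA; have := rP (n + k)%N; have := xP (n + k)%N; lra.
(* The radii halve, so this bound is crude, but it is enough for them to tend to 0. *)
have r_le n : r n <= n.+1%:R^-1.
  rewrite -[leRHS]mul1r ler_pdivlMr ?ltr0n//.
  elim: n => [|n]; first by rewrite mulr1.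
  rewrite -[in X in _ -> X]natr1 -[in X in _ -> X]natr1 -natr1.
  have := rP n; have := r0 n; have : 0 <= n%:R :> R by [].
  nra.
have [l Dl xl] : exists2 l, D l & forall e, 0 < e -> \forall n \near \oo, N (l - x n) <= e.
  apply: Ncomplete => // e e0.
  have [n ne] : exists n, r n <= e.
    exists (Num.truncn e^-1); apply: (le_trans (r_le _)).
    by rewrite invf_ple ?posrE ?ltr0n// ltW// truncnS_gt.
  exists n => m nm; have := ball_le n (m - n)%N; rewrite subnKC//.
  by have := r0 m; lra.
have l_ball n : N (l - x n) <= r n.
  apply/ler_addgt0Pr => e e0.
  have [m _ /(_ (maxn m n) (leq_maxl _ _))] := xl e e0.
  have := ball_le n (maxn m n - n)%N; rewrite subnKC ?leq_maxr//.
  have := ND _ _ (DB _ _ Dl (Dx (maxn m n))) (DB _ _ (Dx (maxn m n)) (Dx n)).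
  by rewrite subrKA; have := r0 (maxn m n); lra.
(* Stage [n] controls ball [n.+1], and [l] lies in all balls; taking [n] above [p l] is
   contradictory. *)
have := large_ball (Num.truncn (p l)).+1 l Dl (l_ball _).
by apply/negP; rewrite -leNgt ltW// truncnS_gt.
Qed.

(** * Algebra on the domain, and weak convergence under a bound *)

Section UnboundedOp.
Context {R : realType} {X : hilbertType R}.
Variable A : unbounded_op X.

Lemma domD x y : dom A x -> dom A y -> dom A (x + y).
Proof. by move=> Ax Ay; rewrite -[x]scale1r; exact: dom_lin. Qed.

Lemma domZ a x : dom A x -> dom A (a *: x).
Proof. by move=> Ax; rewrite -[_ *: _]addr0; apply: dom_lin => //; exact: dom0. Qed.

Lemma domN x : dom A x -> dom A (- x).
Proof. by rewrite -scaleN1r; exact: domZ. Qed.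

Lemma opD x y : dom A x -> dom A y -> A (x + y) = A x + A y.
Proof. by move=> Ax Ay; rewrite -[x in LHS]scale1r op_lin// scale1r. Qed.

Lemma op0 : A 0 = 0.
Proof.
have := opD (dom0 A) (dom0 A); rewrite addr0 => /eqP.
by rewrite -subr_eq subrr => /eqP.
Qed.

Lemma opZ a x : dom A x -> A (a *: x) = a *: A x.
Proof.
by move=> Ax; rewrite -[_ *: x]addr0 op_lin ?op0 ?addr0//; exact: dom0.
Qed.

Lemma opN x : dom A x -> A (- x) = - A x.
Proof. by move=> Ax; rewrite -scaleN1r opZ// scaleN1r. Qed.

Lemma opB x y : dom A x -> dom A y -> A (x - y) = A x - A y.
Proof. by move=> Ax Ay; rewrite opD ?opN//; exact: domN. Qed.

Hypothesis hA : self_adjoint A.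

(** Boundedness makes [A (u t)] converge weakly to [A v]: symmetry settles test vectors in the
    domain, and density with the bound [M] settles the others. Norm convergence of [g] then lets the
    test vector vary too. *)
Lemma cvg_inner_bounded T {F : set_system T} {FF : Filter F}
    (g u : T -> X) (g0 v : X) (M : R) :
  (forall t, dom A (u t)) -> dom A v ->
  g @ F --> g0 -> u @ F --> v -> (\forall t \near F, rnorm (A (u t)) <= M) ->
  (fun t => inner (g t) (A (u t)) : R[i]^o) @ F --> (inner g0 (A v) : R[i]^o).
Proof.
move=> Au Av /cvg_rnormP gg0 /cvg_rnormP uv AM; apply/cvg_rnormP => e e0.
have a0 := rnorm_ge0 (A v); have M0 := normr_ge0 M.
have d0 : 0 < e / (4 * (`|M| + rnorm (A v) + 1)) by rewrite divr_gt0//; lra.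
have [x Ax xg0] := dense_rnorm g0 hA.1 d0.
have x0 := rnorm_ge0 (A x).
have d'0 : 0 < e / (2 * (rnorm (A x) + 1)) by rewrite divr_gt0//; lra.
apply: filterS3 AM (gg0 _ d0) (uv _ d'0) => t AM gt ut.
set d := e / (4 * _) in xg0 gt d0; set d' := e / _ in ut d'0.
have dE : d * (`|M| + rnorm (A v) + 1) = e / 4 by rewrite /d; field; lra.
have d'E : d' * (rnorm (A x) + 1) = e / 2 by rewrite /d'; field; lra.
(* Here [x] in the domain replaces [g0]. The first two terms use the bound [M], the third moves [A]
   onto [x], the fourth has [A v] fixed. The third is at most [e / 2], and the others together at
   most [e / 2]. *)
have -> : inner (g t) (A (u t)) - inner g0 (A v) =
    inner (g t - g0) (A (u t)) + inner (g0 - x) (A (u t)) + inner (A x) (u t - v) +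
    inner (x - g0) (A v).
  by rewrite !innerBl innerBr !(self_adjoint_sym hA)//; ring.
have := cauchy_schwarz (g t - g0) (A (u t)).
have := cauchy_schwarz (g0 - x) (A (u t)); rewrite rdistC.
have := cauchy_schwarz (A x) (u t - v).
have := cauchy_schwarz (x - g0) (A v).
have {AM} : rnorm (A (u t)) <= `|M| := le_trans AM (ler_norm _).
have := rnorm_ge0 (A (u t)).
set p1 := inner (g t - _) _; set p2 := inner (g0 - x) _; set p3 := inner _ (u t - v).
set p4 := inner _ (A v).
have := rnorm_ge0 (x - g0); have := rnorm_ge0 (g t - g0).
have := rnorm_ge0 (u t - v).
move: (rnorm (x - g0)) xg0 (rnorm (g t - g0)) gt (rnorm (u t - v)) ut => y1 h1 y2 h2 y3 h3.
move: (rnorm (A (u t))) => m y30 y20 y10 m0 mM.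
move=> c4 c3 c2 c1.
have b1 : y1 * m <= d * `|M| by apply: ler_pM => //; exact: ltW.
have b2 : y2 * m <= d * `|M| by exact: ler_pM.
have b3 : rnorm (A x) * y3 <= rnorm (A x) * d' by exact: ler_wpM2l.
have b4 : y1 * rnorm (A v) <= d * rnorm (A v) by apply: ler_wpM2r => //; exact: ltW.
have b5 : 0 <= d * rnorm (A v) by rewrite mulr_ge0// ltW.
apply: (le_trans (rnormD _ _)); apply: (le_trans (lerD (rnormD _ _) (lexx _))).
apply: (le_trans (lerD (lerD (rnormD _ _) (lexx _)) (lexx _))).
lra.
Qed.

End UnboundedOp.

Lemma self_adjoint_cauchy (R : realType) (X : hilbertType R) (A : unbounded_op X)
    (hA : self_adjoint A) (u : nat -> X) (l : X) :
  (forall n, dom A (u n)) -> u @ \oo --> l ->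
  (forall e, 0 < e -> exists n, forall m, (n <= m)%N ->
     rnorm (A (u m) - A (u n)) <= e) ->
  dom A l /\ (fun n => A (u n)) @ \oo --> A l.
Proof.
move=> Au ul /rnorm_cauchy[a ua].
by have [Al ->] := self_adjoint_closed hA Au ul ua.
Qed.

(** * Orbits of the unitary group and its generator *)

Section UnitaryGroup.
Context {R : realType} {X : hilbertType R}.
Variable U : R -> {linear X -> X}.
Hypothesis hU : unitary_group U.

Lemma unitary_rnorm t x : rnorm (U t x) = rnorm x.
Proof.
case: hU => _ _ Uinner _; have := Uinner t x x; rewrite !inner_norm => /complexI.
by move/eqP; rewrite eqrXn2 ?rnorm_ge0// => /eqP.
Qed.

Variable H : unbounded_op X.
Hypothesis genU : graph H =
  [set p | has_derivative (fun t => U t p.1) 0 (- ('i *: p.2))].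

(** The difference quotient at [t] is [U t] applied to the one at 0, and [U t] is an isometry. *)
Lemma unitary_has_derivative t x : dom H x ->
  has_derivative (fun s => U s x) t (- ('i *: U t (H x))).
Proof.
move=> Hx; have : graph H (x, H x) by [].
rewrite genU /= => /cvg_rnormP d0; apply/cvg_rnormP => e /d0.
apply: filterS => h; rewrite addr0.
case: hU => U0 UD _ _; rewrite (addrC h) UD U0.
have -> : (h^-1)%:C *: (U t (U h x) - U t x) - - ('i *: U t (H x)) =
    U t ((h^-1)%:C *: (U h x - x) - - ('i *: H x)).
  have UZ a y : U t (a *: y) = a *: U t y by exact: linearZ.
  by rewrite (raddfB (U t)) (raddfN (U t)) /= !UZ (raddfB (U t)).
by rewrite unitary_rnorm.
Qed.

(** The quotient at 0 along the orbit of [U t x] is the quotient at [t] along the orbit of [x]. It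
    converges, and maximality of the generator's domain puts [U t x] in [dom H]. *)
Lemma generator_commutes t x : dom H x -> dom H (U t x) /\ H (U t x) = U t (H x).
Proof.
move=> Hx; suff : graph H (U t x, U t (H x)) by case.
rewrite genU /=; have := unitary_has_derivative (t := t) Hx.
case: hU => U0 UD _ _; rewrite /has_derivative.
by under eq_fun do rewrite UD -[in X in _ - X](U0 (U t x)) -[X in U X _](addr0).
Qed.

End UnitaryGroup.

(** * Local boundedness of [A] along orbits *)

Section LocalBound.
Context {R : realType} {X : hilbertType R}.
Variables A H : unbounded_op X.
Hypotheses (hA : self_adjoint A) (hH : self_adjoint H).

(** Controlling both [A x] and [H x] makes the intersection of the domains complete, both operators
    being closed. *)
Definition graph_norm x : R := rnorm x + rnorm (A x) + rnorm (H x).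

Lemma graph_norm_complete (u : nat -> X) :
  (forall n, (dom A `&` dom H) (u n)) ->
  (forall e, 0 < e -> exists n, forall m, (n <= m)%N -> graph_norm (u m - u n) <= e) ->
  exists2 l, (dom A `&` dom H) l &
    forall e, 0 < e -> \forall n \near \oo, graph_norm (l - u n) <= e.
Proof.
move=> Du cu; have Au n := (Du n).1; have Hu n := (Du n).2.
have [l ul] : exists l : X, u @ \oo --> l.
  apply: rnorm_cauchy => e /cu[n un]; exists n => m /un; apply/le_trans.
  by rewrite /graph_norm -addrA lerDl addr_ge0 ?rnorm_ge0.
have [|Al ual] := self_adjoint_cauchy hA Au ul.
  move=> e /cu[n un]; exists n => m /un; apply/le_trans.
  by rewrite -opB// /graph_norm addrAC lerDr addr_ge0 ?rnorm_ge0.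
have [|Hl uhl] := self_adjoint_cauchy hH Hu ul.
  move=> e /cu[n un]; exists n => m /un; apply/le_trans.
  by rewrite -opB// /graph_norm lerDr addr_ge0 ?rnorm_ge0.
exists l => // e e0; have e30 : 0 < e / 3 by lra.
move/cvg_rnormP : ul => /(_ _ e30) ul.
move/cvg_rnormP : ual => /(_ _ e30) ual.
move/cvg_rnormP : uhl => /(_ _ e30) uhl.
apply: filterS3 ul ual uhl => n.
rewrite /graph_norm !opB// rdistC [rnorm (A _ - _)]rdistC [rnorm (H _ - _)]rdistC.
lra.
Qed.

Variable U : R -> {linear X -> X}.
Hypothesis hU : unitary_group_generated_by H U.
Hypothesis hinv : forall (t : R) (psi : X),
  (dom A `&` dom H) psi -> (dom A `&` dom H) (U t psi).

(** Invariance makes [A] composed with [U t] defined on the whole intersection. Its norm is lower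
    semicontinuous there, because [U t] is isometric and [graph_norm] dominates [rnorm]. *)
Lemma graph_bounded t : exists r C, 0 < r /\
  forall x, (dom A `&` dom H) x -> graph_norm x <= r -> rnorm (A (U t x)) <= C.
Proof.
have UA x : (dom A `&` dom H) x -> dom A (U t x) by move=> /(hinv t)[].
apply: lsc_seminorm_bounded.
- by split; exact: dom0.
- by move=> x y [Ax Hx] [Ay Hy]; split; exact: domD.
- by move=> x [Ax Hx]; split; exact: domN.
- by rewrite /graph_norm !op0 !rnorm0 !addr0.
- move=> x y [Ax Hx] [Ay Hy]; rewrite /graph_norm !opD//.
  have := rnormD x y; have := rnormD (A x) (A y); have := rnormD (H x) (H y).
  lra.
- exact: graph_norm_complete.
- by move=> x Dx; rewrite linearN opN ?rnormN//; exact: UA.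
- by move=> x y Dx Dy; rewrite linearD opD ?rnormD//; exact: UA.
- move=> x c Dx /(self_adjoint_lsc hA (UA _ Dx))[d d0 dP]; exists d => // z Dz zd.
  apply: dP; first exact: UA.
  rewrite -linearB (unitary_rnorm hU.1); apply: le_trans zd.
  by rewrite /graph_norm -addrA lerDl addr_ge0 ?rnorm_ge0.
Qed.

Lemma interval_bounded psi : (dom A `&` dom H) psi ->
  exists (t : R) (M : R), \forall s \near t, rnorm (A (U s psi)) <= M.
Proof.
move=> Dpsi; have UA t : dom A (U t psi) by have [] := hinv t Dpsi.
pose O n := [set t | n%:R < rnorm (A (U t psi))].
have openO n : open (O n).
  rewrite openE => t Ot; rewrite /interior.
  have [|d d0 dP] := self_adjoint_lsc hA (UA t) (c := n%:R).
    by rewrite ler0n.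
  case: hU => -[_ _ _ /(_ psi t)/cvg_rnormP/(_ d d0)] + _.
  by apply: filterS => s; exact: dP.
(* Were all [O n] dense, Baire's theorem on the real line would give a time at which the norm
   exceeds every integer. A non-dense [O n] misses an open set, on which [n] is a bound. *)
have [n nO] : exists n, ~ dense (O n).
  apply: contrapT => H0.
  have /Baire : forall n, open (O n) /\ dense (O n).
    by move=> n; split => //; apply: contrapT => ?; apply: H0; exists n.
  move=> /(_ setT (ex_intro _ (0 : R) Logic.I) openT)[t [_ tO]].
  have := tO (Num.truncn (rnorm (A (U t psi)))).+1 Logic.I.
  by apply/negP; rewrite -leNgt ltW// truncnS_gt.
have [V [[t Vt] VO]] := denseNE nO.
exists t, n%:R; apply: filterS (open_nbhs_nbhs Vt) => s Vs.
by rewrite leNgt; apply/negP => Os; rewrite -[False]/(set0 s) -VO.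
Qed.

Lemma locally_bounded psi : (dom A `&` dom H) psi ->
  forall t : R, exists M : R, \forall s \near t, rnorm (A (U s psi)) <= M.
Proof.
move=> Dpsi t; have [t0 [M MP]] := interval_bounded Dpsi.
have [r [C [r0 CP]]] := graph_bounded (t - t0).
(* [K] dominates [graph_norm] along the orbit at times near [t0], since [U] preserves the norms of
   [psi] and [H psi]. Scaling by [a = r / K] brings those vectors into the ball of [graph_bounded];
   undoing it gives [C / a]. *)
pose K := rnorm psi + `|M| + rnorm (H psi) + 1.
have K0 : 0 < K.
  by rewrite /K; have := rnorm_ge0 psi; have := rnorm_ge0 (H psi); have := normr_ge0 M; lra.
pose a := r / K; have a0 : 0 < a by rewrite divr_gt0.
exists (C / a).
have : (fun s => s + (t0 - t)) @ t --> t + (t0 - t).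
  by apply: cvgD; [exact: cvg_id|exact: cvg_cst].
rewrite subrKC => /(_ _ MP) {}MP.
have {}MP : \forall s \near t, rnorm (A (U (s + (t0 - t)) psi)) <= M by exact: MP.
apply: filterS MP => s MP.
have Dy := hinv (s + (t0 - t)) Dpsi; set y := U _ psi in MP Dy.
have -> : U s psi = U (t - t0) y.
  case: hU => -[_ UD _ _] _; rewrite /y -UD; congr (U _ psi); lra.
rewrite ler_pdivlMr// mulrC -[X in X * _](ger0_norm (ltW a0)) -rnormZr.
have [AUy _] := hinv (t - t0) Dy; rewrite -opZ//.
have -> : a%:C *: U (t - t0) y = U (t - t0) (a%:C *: y) by rewrite linearZ.
case: Dy => Ay Hy.
apply: CP; first by split; exact: domZ.
rewrite /graph_norm !opZ//.
rewrite !rnormZr (ger0_norm (ltW a0)) -!mulrDr.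
have -> : r = a * K by rewrite /a divfK ?gt_eqF.
rewrite ler_pM2l//.
have [_ ->] := generator_commutes hU.1 hU.2 (s + (t0 - t)) Dpsi.2.
rewrite !(unitary_rnorm hU.1) /K; have := ler_norm M; lra.
Qed.

End LocalBound.

(** * Differentiation of the expectation *)

Lemma cvg_conjc (R : realType) T {F : set_system T} {FF : Filter F}
    (f : T -> R[i]^o) (l : R[i]^o) :
  f @ F --> l -> (fun t => (f t)^*%C : R[i]^o) @ F --> (l^*%C : R[i]^o).
Proof.
move=> /cvg_rnormP fl; apply/cvg_rnormP => e /fl; apply: filterS => t.
by rewrite /rnorm -[_ - _^*%C](raddfB (@conjc R)) normcJ.
Qed.

Theorem theorem1 (R : realType) (X : hilbertType R) (A H : unbounded_op X)
    (hA : self_adjoint A) (hH : self_adjoint H)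
    (U : R -> {linear X -> X}) (hU : unitary_group_generated_by H U)
    (hinv : forall (t : R) (psi : X),
       (dom A `&` dom H) psi -> (dom A `&` dom H) (U t psi))
    (psi0 : X) (hpsi0 : (dom A `&` dom H) psi0) :
  let f : R -> R[i]^o := fun t => op_expectation A (U t psi0) in
  continuously_differentiable f /\
  forall t : R,
    has_derivative f t ('i * commutator_expectation H A (U t psi0)).
Proof.
move=> f.
have AU t : dom A (U t psi0) by have [] := hinv t _ hpsi0.
have HU t : H (U t psi0) = U t (H psi0).
  by have [] := generator_commutes hU.1 hU.2 t hpsi0.2.
have bounded := locally_bounded hA hH hU hinv hpsi0.
have [[_ _ _ Ucont] _] := hU.
have df (t : R) : has_derivative f t ('i * commutator_expectation H A (U t psi0)).
  have [M MP] := bounded t.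
  have ht : (fun h : R => h + t) @ 0^' --> t.
    rewrite -[X in _ --> X]add0r; apply: cvgD; last exact: cvg_cst.
    exact: cvg_within.
  have Ut : (fun h => U (h + t) psi0) @ 0^' --> U t psi0.
    exact: (cvg_comp _ _ ht (Ucont psi0 t)).
  have Mt : \forall h \near 0^', rnorm (A (U (h + t) psi0)) <= M by have := ht _ MP; exact.
  have dU := unitary_has_derivative hU.1 hU.2 (t := t) hpsi0.2.
  rewrite /has_derivative.
  (* By symmetry of [A] the cross terms cancel. The second summand is written as a conjugate so that
     the difference quotient always stands in the first argument. *)
  have -> : (fun h : R => (h^-1)%:C *: (f (h + t) - f t)) = (fun h =>
      inner ((h^-1)%:C *: (U (h + t) psi0 - U t psi0)) (A (U (h + t) psi0)) +
      (inner ((h^-1)%:C *: (U (h + t) psi0 - U t psi0)) (A (U t psi0)))^*%C).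
    apply/funext => h; rewrite inner_conj innerZl innerZr innerBl innerBr conjc_real.
    rewrite /f /op_expectation !(self_adjoint_sym hA)// -mulrDr.
    by rewrite addrA subrK.
  (* The orbit has derivative [- ('i *: U t (H psi0))]; antilinearity turns the factor [- 'i] into
     ['i] in the first summand, and the conjugate supplies the opposite sign. *)
  have -> : 'i * commutator_expectation H A (U t psi0) =
      inner (- ('i *: U t (H psi0))) (A (U t psi0)) +
      (inner (- ('i *: U t (H psi0))) (A (U t psi0)))^*%C.
    rewrite /commutator_expectation HU inner_conj innerNl innerNr innerZl innerZr.
    have -> : 'i^*%C = - 'i :> R[i] by rewrite /conjc/=; congr Complex; rewrite oppr0.
    ring.
  exact: cvgD (cvg_inner_bounded hA (fun h => AU (h + t)) (AU t) dU Ut Mt)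
    (cvg_conjc (cvg_innerl dU)).
split=> //; exists (fun t => 'i * commutator_expectation H A (U t psi0)) => // t.
have [M MP] := bounded t.
(* [H] commutes with the group, so [H (U s psi0)] is norm continuous in [s] and can serve as the
   varying test vector against the weakly continuous [A (U s psi0)]. *)
have Hcont : (fun s => H (U s psi0)) @ t --> H (U t psi0).
  by rewrite HU; under eq_fun do rewrite HU; exact: Ucont.
have c : (fun s => inner (H (U s psi0)) (A (U s psi0)) : R[i]^o) @ t -->
    (inner (H (U t psi0)) (A (U t psi0)) : R[i]^o).
  exact: (cvg_inner_bounded (FF := nbhs_filter t) hA AU (AU t) Hcont (Ucont psi0 t) MP).
rewrite /commutator_expectation.
(* The two halves of the commutator are conjugate, so continuity of one gives that of the other. *)
under eq_fun do rewrite -[inner (A _) _]inner_conj.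
apply: cvgZl_tmp; apply: cvgB; first exact: c.
exact: (cvg_conjc (FF := nbhs_filter t) c).
Qed.
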